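(* Let $w$ be a word of length $n$ with $m$ blocks. Then for every fixed length, $w$ contains at most $m$ pairwise nonequivalent Abelian squares of that length. Consequently, $\mathit{SQ}'_{\mathrm{Abel}}(w)\le \frac{nm}{2}$.
   Context: A block of $w$ is a maximal fragment $w[i..j]$ all of whose letters are equal (it cannot be extended to the left or right). For a word $x$ over $\{0,\ldots,\sigma-1\}$, $P(x)=(|x|_0,\ldots,|x|_{\sigma-1})$ is its Parikh vector. An Abelian square is a word $uv$ with $u,v$ nonempty, $|u|=|v|$ and $P(u)=P(v)$; two Abelian squares are equivalent if they have the same Parikh vector. $\mathit{SQ}'_{\mathrm{Abel}}(w)$ is the number of pairwise nonequivalent Abelian squares occurring as subwords (contiguous factors) of $w$. *)

(* Defs.v *)
From mathcomp Require Import all_boot all_order all_algebra.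

Set Implicit Arguments.
Unset Strict Implicit.
Unset Printing Implicit Defensive.

Section AbelianSquares.
Variable sigma : nat.
Implicit Types w u x y : seq 'I_sigma.

(* Positions are numbered from 0; both ends are included. *)
Definition fragment w (i j : nat) : seq 'I_sigma := take (j.+1 - i) (drop i w).

Definition unary_fragment w (i j : nat) : bool :=
  [&& i <= j, j < size w & constant (fragment w i j)].

Definition is_block w (i j : nat) : bool :=
  [&& unary_fragment w i j,
      ~~ ((0 < i) && unary_fragment w i.-1 j)
    & ~~ unary_fragment w i j.+1].

Definition num_blocks w : nat :=
  #|[set p : 'I_(size w) * 'I_(size w) | is_block w p.1 p.2]|.

Definition parikh u : {ffun 'I_sigma -> nat} := [ffun a => count_mem a u].

Definition abelian_equiv x y : bool := parikh x == parikh y.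

Definition abelian_square u : bool :=
  [exists k : 'I_(size u).+1,
     let x := take k u in let y := drop k u in
     [&& x != [::], y != [::], size x == size y & parikh x == parikh y]].

Lemma abelian_squareP u :
  reflect (exists x y, [/\ u = x ++ y, x <> [::], y <> [::],
                           size x = size y & parikh x = parikh y])
          (abelian_square u).
Proof.
apply: (iffP existsP) => [[k] /and4P[/eqP nx /eqP ny /eqP es /eqP ep]|].
  by exists (take k u), (drop k u); split=> //; rewrite cat_take_drop.
case=> x [y [-> nx ny es ep]].
have lt_x : size x < (size (x ++ y)).+1 by rewrite ltnS size_cat leq_addr.
exists (Ordinal lt_x); rewrite /= take_size_cat // drop_size_cat //.
by apply/and4P; split; apply/eqP.
Qed.

(* All nonempty contiguous factors, listed once per occurrence. *)
Definition factors w : seq (seq 'I_sigma) :=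
  [seq fragment w i j | i <- iota 0 (size w), j <- iota i (size w - i)].

Lemma mem_factors w u : (u \in factors w) = (u != [::]) && infix u w.
Proof.
apply/allpairsPdep/andP=> [[i [j [+ + ->]]]|[nu /infixP[p [s ->]]]].
  rewrite !mem_iota add0n => /andP[_ lt_i] /andP[le_ij lt_j].
  rewrite (subnKC (ltnW lt_i)) in lt_j.
  split; last first.
    by rewrite /fragment; apply: infix_trans (infix_take _ _) (infix_drop _ _).
  rewrite -size_eq0 size_take size_drop.
  by case: ifP => _; rewrite subn_eq0 -ltnNge ?ltnS.
have u_gt0 : 0 < size u by rewrite lt0n size_eq0.
exists (size p), (size p + (size u).-1).
rewrite !mem_iota !size_cat add0n /= addKn leq_addr /=; split.
- by rewrite -[X in X < _]addn0 ltn_add2l ltn_addr.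
- by rewrite ltn_add2l ltn_addr // prednK.
- by rewrite /fragment -addnS prednK // addKn drop_size_cat // take_size_cat.
Qed.

(* Equivalence classes correspond to Parikh vectors, so the classes of the
   Abelian squares occurring in w are counted by their distinct vectors. *)
Definition SQ'_Abel w : nat :=
  size (undup [seq parikh u | u <- factors w & abelian_square u]).

End AbelianSquares.

(* Main.v *)
(* An Abelian square of length 2k occurring at position i is charged to the
   block containing its middle position i + k.  Suppose two squares of length
   2k, at positions i <= i', are charged to the same block.  Then the letters
   at positions i + k, ..., i' + k - 1 are all equal to some letter a.  Write
   F c p for the number of occurrences of c among the first p letters.  A
   square at i means 2 F c (i + k) = F c i + F c (i + 2k); subtracting the two
   equations, the increments of F c over [i, i') and [i + 2k, i' + 2k) add up
   to 2 (i' - i) if c = a, and to 0 otherwise, so both are extremal, hence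
   equal, and the two squares have the same Parikh vector. *)
Require Import Defs.
From mathcomp Require Import all_boot all_order all_algebra.
From mathcomp Require Import zify.

Set Implicit Arguments.
Unset Strict Implicit.
Unset Printing Implicit Defensive.

Import GRing.Theory Num.Theory.

(** Choosing for each [x] some related [b] in [A] gives an injection. A relation suits squares
    better than a map: a square may occur at several places and so be related to several blocks. *)
Lemma leq_size_injective_rel (T : eqType) (B : finType) (A : {set B})
    (r : T -> B -> bool) (s : seq T) :
  uniq s ->
  {in s, forall x, exists2 b, b \in A & r x b} ->
  {in s &, forall x y b, r x b -> r y b -> x = y} ->
  size s <= #|A|.
Proof.
move=> us ex inj; pose f x := [pick b in A | r x b].
have fP x : x \in s -> exists2 b, b \in A & f x = Some b /\ r x b.
  move=> /ex[b bA rxb]; rewrite /f; case: pickP => [c /andP[cA rxc]|/(_ b)].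
    by exists c.
  by rewrite /= bA rxb.
rewrite -(size_map f) cardE -(size_map Some (enum A)); apply: uniq_leq_size.
  rewrite map_inj_in_uniq // => x y xs ys.
  case: (fP x xs) => b _ [-> rxb]; case: (fP y ys) => c _ [-> ryc] [ebc].
  by apply: (inj x y xs ys b) => //; rewrite ebc.
move=> _ /mapP[x xs ->]; case: (fP x xs) => b bA [-> _].
by apply: map_f; rewrite mem_enum.
Qed.

Lemma uniq_map_inj_in (T T' : eqType) (f : T -> T') (s : seq T) :
  uniq (map f s) -> {in s &, injective f}.
Proof.
elim: s => //= z s IHs /andP[zs us] x y; rewrite !inE.
case/predU1P=> [->|xs] /predU1P[->|ys] // fxy; last exact: IHs.
  by rewrite fxy map_f in zs.
by rewrite -fxy map_f in zs.
Qed.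

Lemma constant_infix (T : eqType) (s t : seq T) :
  infix t s -> constant s -> constant t.
Proof.
case/infixP=> p [q ->]; case: t => //= x t cst.
(* [constant] compares with the head of the word, which changes on passing to an infix, so a common
   letter [z] is named first. *)
have [z] : exists z, all (pred1 z) (p ++ (x :: t) ++ q).
  case: (p ++ _) cst => [|y s']; first by exists x.
  by move=> /= cst; exists y; rewrite /= eqxx.
by rewrite !all_cat /= => /and3P[_ /andP[/eqP ->]].
Qed.

Section Words.
Variable sigma : nat.
Implicit Types (w u v : seq 'I_sigma) (c : 'I_sigma).

Lemma fragment_infix w i j i' j' :
  i <= i' -> i' <= j' -> j' <= j ->
  infix (fragment w i' j') (fragment w i j).
Proof.
move=> le_i le_ij le_j; have -> : fragment w i' j' =
    take (j'.+1 - i') (drop (i' - i) (fragment w i j)).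
  rewrite /fragment [RHS]take_drop take_takel; last by lia.
  by rewrite -take_drop drop_drop subnK.
exact: infix_trans (infix_take _ _) (infix_drop _ _).
Qed.

Lemma unary_fragment_sub w i j i' j' :
  i <= i' -> i' <= j' -> j' <= j ->
  unary_fragment w i j -> unary_fragment w i' j'.
Proof.
move=> le_i le_ij le_j /and3P[_ lt_j cst]; apply/and3P; split=> //.
  exact: leq_ltn_trans lt_j.
exact: constant_infix (fragment_infix _ _ _ _) cst.
Qed.

Lemma unary_fragment_refl w p : p < size w -> unary_fragment w p p.
Proof.
move=> lt_p; apply/and3P; split=> //; rewrite /fragment subSnn.
by case: (drop p w) => // x s; rewrite /= take0.
Qed.

(** The single letter at [p] is extended as far left as possible, then as far right as possible. *)
Lemma block_cover w p : p < size w ->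
  exists i j : 'I_(size w), is_block w i j /\ i <= p <= j.
Proof.
move=> lt_p; have upp := unary_fragment_refl lt_p.
have exi : exists i, unary_fragment w i p by exists p.
case: (ex_minnP exi) => i uip mini.
have le_ip : i <= p by case/and3P: uip.
have exj : exists j, unary_fragment w i j by exists p.
have bndj j : unary_fragment w i j -> j <= size w by case/and3P=> _ /ltnW.
case: (ex_maxnP exj bndj) => j uij maxj.
have le_pj := maxj _ uip.
have lt_j : j < size w by case/and3P: uij.
have lt_i : i < size w by apply: leq_ltn_trans lt_p.
exists (Ordinal lt_i), (Ordinal lt_j); rewrite le_ip le_pj; split=> //.
apply/and3P; split=> //=.
  (* [i] is minimal for the right end [p], not [j], so the longer fragment is first cut back to end
     at [p]. *)
  apply/negP=> /andP[i_gt0 uj]; have : unary_fragment w i.-1 p.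
    by apply: unary_fragment_sub uj => //; lia.
  by move/mini; lia.
by apply/negP=> /maxj; lia.
Qed.

Lemma abelian_square_halves u : abelian_square u ->
  let k := (size u)./2 in
  [/\ 0 < k, size u = k + k
    & forall c, count_mem c (take k u) = count_mem c (drop k u)].
Proof.
case/abelian_squareP=> x [y [-> nx _ es ep]] k.
have kE : k = size x by rewrite /k size_cat -es; lia.
split; first by rewrite kE lt0n size_eq0; apply/eqP.
- by rewrite kE size_cat -es.
- move=> c; rewrite kE take_size_cat // drop_size_cat //.
  by have /ffunP/(_ c) := ep; rewrite !ffunE.
Qed.

Definition occurs_at w u (i : nat) :=
  (i + size u <= size w) && (u == take (size u) (drop i w)).

Lemma infix_occurs_at w u : infix u w -> exists i, occurs_at w u i.
Proof.
case/infixP=> p [q ->]; exists (size p); rewrite /occurs_at !size_cat.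
by rewrite drop_size_cat // take_size_cat // eqxx andbT addnA leq_addr.
Qed.

(** The function F of the overview. *)
Definition prefix_count w c (p : nat) := count_mem c (take p w).

Lemma prefix_countD w c p d :
  prefix_count w c (p + d) =
  prefix_count w c p + count_mem c (take d (drop p w)).
Proof. by rewrite /prefix_count takeD count_cat. Qed.

Lemma leq_prefix_countD w c p d :
  prefix_count w c p <= prefix_count w c (p + d) <= prefix_count w c p + d.
Proof.
rewrite prefix_countD leq_addr leq_add2l.
by apply: leq_trans (count_size _ _) _; rewrite size_take_min geq_minl.
Qed.

(** In a run of a single letter, [c] occurs either nowhere or everywhere. *)
Lemma prefix_count_unary w c p d : unary_fragment w p (p + d) ->
  prefix_count w c (p + d) = prefix_count w c p \/
  prefix_count w c (p + d) = prefix_count w c p + d.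
Proof.
case/and3P=> _ lt_pd; rewrite prefix_countD /fragment => cst.
(* The fragment includes its right end and has [d + 1] letters; the increment counts only the first
   [d]. *)
have {cst} : constant (take d (drop p w)).
  apply: constant_infix cst; rewrite (_ : take d _ =
    take d (take ((p + d).+1 - p) (drop p w))) ?infix_take //.
  by rewrite take_takel //; lia.
have sz : size (take d (drop p w)) = d by rewrite size_takel // size_drop; lia.
case/(constantP c)=> x ->; rewrite sz count_nseq /=.
by case: (x == c); lia.
Qed.

Lemma parikh_occurs_at w u i c : occurs_at w u i ->
  prefix_count w c (i + size u) = prefix_count w c i + parikh u c.
Proof. by case/andP=> _ /eqP uE; rewrite prefix_countD -uE ffunE. Qed.

Lemma abelian_square_prefix_count w u i c (k := (size u)./2) :
  abelian_square u -> occurs_at w u i ->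
  2 * prefix_count w c (i + k) = prefix_count w c i + prefix_count w c (i + k + k).
Proof.
case/abelian_square_halves=> _ szu /(_ c); rewrite -/k in szu *.
move=> + /andP[_ /eqP uE]; rewrite szu in uE; rewrite uE.
rewrite take_takel ?leq_addl //.
have -> : drop k (take (k + k) (drop i w)) = take k (drop (i + k) w).
  by rewrite -take_drop drop_drop addnC.
by rewrite !prefix_countD; lia.
Qed.

(** The center is the first letter of the second half; any occurrence of [u] may supply it. *)
Definition center_in_block w u (b : 'I_(size w) * 'I_(size w)) :=
  [exists i : 'I_(size w),
     occurs_at w u i && (b.1 <= i + (size u)./2 <= b.2)].

Lemma center_block w u : infix u w -> abelian_square u ->
  exists2 b : 'I_(size w) * 'I_(size w),
    is_block w b.1 b.2 & center_in_block u b.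
Proof.
case/infix_occurs_at=> i oi /abelian_square_halves[k_gt0 szu _].
have le_i : i + size u <= size w by case/andP: oi.
have lt_i : i < size w by lia.
have lt_k : i + (size u)./2 < size w by lia.
case: (block_cover lt_k) => a [b [blk kab]].
by exists (a, b) => //; apply/existsP; exists (Ordinal lt_i); rewrite oi.
Qed.

Lemma center_block_parikh w u v (b : 'I_(size w) * 'I_(size w)) :
  is_block w b.1 b.2 -> abelian_square u -> abelian_square v ->
  size u = size v -> center_in_block u b -> center_in_block v b ->
  parikh u = parikh v.
Proof.
move=> /and3P[ub _ _] squ sqv es /existsP[i /andP[oi bi]] /existsP[j /andP[oj bj]].
move: (nat_of_ord i) (nat_of_ord j) oi oj bi bj => {}i {}j.
wlog le_ij : u v i j squ sqv es / i <= j.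
  move=> hw oi oj bi bj; case: (leqP i j) => [|/ltnW] le_ij.
    exact: (hw u v i j).
  by apply: esym; apply: (hw v u j i).
move=> oi oj bi bj; apply/ffunP=> c.
have := abelian_square_prefix_count c sqv oj.
have := abelian_square_prefix_count c squ oi.
have := parikh_occurs_at c oj; have := parikh_occurs_at c oi.
have [k_gt0 szu _] := abelian_square_halves squ.
rewrite -es in bj *; move: ((size u)./2) szu k_gt0 bi bj => k -> k_gt0 bi bj.
(* With [d] the distance between the occurrences, the second is the first shifted by [d], and so are
   its center and its end. *)
have jE : j = i + (j - i) by rewrite subnKC.
move: (j - i) jE => d jE; rewrite {j le_ij oj}jE in bj *.
rewrite !addnA !(addnAC i d) !(addnAC _ d k).
have umid : unary_fragment w (i + k) (i + k + d).
  by apply: unary_fragment_sub ub; lia.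
have := leq_prefix_countD w c i d; have := leq_prefix_countD w c (i + k + k) d.
have := prefix_count_unary c umid.
move: (prefix_count w c) (parikh u c) (parikh v c) => F pu pv.
(* Twice the middle increment, 0 or [2 * d], is the sum of two outer increments, each between 0 and
   [d]; these are therefore equal, which gives [pu = pv]. *)
by case; lia.
Qed.

Definition squares_in w (s : seq (seq 'I_sigma)) :=
  {in s, forall u, infix u w /\ abelian_square u}.

Lemma size_squares_length w l (s : seq (seq 'I_sigma)) :
  squares_in w s -> {in s, forall u, size u = l} -> uniq (map (@parikh _) s) ->
  size s <= num_blocks w.
Proof.
move=> sqs szs up; have inj := uniq_map_inj_in up.
rewrite /num_blocks.
apply: (leq_size_injective_rel
  (r := fun u (b : 'I_(size w) * 'I_(size w)) =>
    is_block w b.1 b.2 && center_in_block u b)).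
- exact: map_uniq up.
- move=> u us; have [infu squ] := sqs u us.
  have [b blk cb] := center_block infu squ.
  by exists b; rewrite ?inE ?blk.
- move=> u v us vs b /andP[blk cu] /andP[_ cv]; apply: inj => //.
  have [[_ squ] [_ sqv]] := (sqs u us, sqs v vs).
  by apply: center_block_parikh cu cv => //; rewrite !szs.
Qed.

(** All lengths are treated at once, by charging a square to its half-length together with a
    block. *)
Lemma size_squares w (s : seq (seq 'I_sigma)) :
  squares_in w s -> uniq (map (@parikh _) s) ->
  size s <= (size w)./2 * num_blocks w.
Proof.
move=> sqs up; have inj := uniq_map_inj_in up.
rewrite /num_blocks -[X in X * _]card_ord -cardsT -cardsX.
apply: (leq_size_injective_rel
  (r := fun u (kb : 'I_(size w)./2 * ('I_(size w) * 'I_(size w))) =>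
    [&& is_block w kb.2.1 kb.2.2, center_in_block u kb.2
      & size u == (kb.1 : nat).+1.*2])).
- exact: map_uniq up.
- move=> u us; have [infu squ] := sqs u us.
  have [b blk cb] := center_block infu squ.
  have [k_gt0 szu _] := abelian_square_halves squ.
  have le_uw : size u <= size w := size_infix infu.
  (* Half-lengths start at 1 and ordinals at 0, hence the shift by one. *)
  have lt_k : (size u)./2.-1 < (size w)./2 by lia.
  exists (Ordinal lt_k, b); first by rewrite !inE.
  by rewrite blk cb /=; apply/eqP; lia.
- move=> u v us vs kb /and3P[blk cu /eqP su] /and3P[_ cv /eqP sv].
  have [[_ squ] [_ sqv]] := (sqs u us, sqs v vs).
  by apply: inj => //; apply: center_block_parikh cu cv => //; rewrite su sv.
Qed.

End Words.

Theorem theorem14 (sigma : nat) (w : seq 'I_sigma) (n m : nat)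
    (hn : size w = n) (hm : num_blocks w = m) :
  (forall (l : nat) (S : seq (seq 'I_sigma)),
     (forall u : seq 'I_sigma, u \in S ->
        [/\ infix u w, abelian_square u & size u = l]) ->
     pairwise (fun x y => ~~ abelian_equiv x y) S ->
     (size S <= m)%N)
  /\ ((SQ'_Abel w)%:R <= n%:R * m%:R / 2%:R :> rat)%R.
Proof.
rewrite -hn -hm; split.
  move=> l S SP pw; apply: (@size_squares_length _ _ l) => [u|u|].
  - by case/SP.
  - by case/SP.
  - by rewrite uniq_pairwise pairwise_map.
(* [s] picks one representative square for each Parikh vector counted. *)
have [s sP sE] : exists2 s, all (mem [seq u <- factors w | abelian_square u]) s &
    undup [seq parikh u | u <- factors w & abelian_square u] = map (@parikh _) s.
  by apply/subset_mapP=> p; rewrite mem_undup.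
have le_s : size s <= (size w)./2 * num_blocks w.
  apply: size_squares; last by rewrite -sE undup_uniq.
  move=> u /(allP sP); rewrite /= mem_filter mem_factors.
  by case/and3P=> squ _ infu.
rewrite /SQ'_Abel sE size_map ler_pdivlMr // -!natrM ler_nat.
(* With the denominator cleared, it remains that twice the rounded-down half of [size w] is at most
   [size w]. *)
apply: leq_trans (leq_mul le_s (leqnn 2)) _; rewrite mulnAC leq_mul2r.
by apply/orP; right; lia.
Qed.
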